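(* Let $\mathcal{A}$ be a separable Banach space with Borel sigma algebra $\mathcal{B}(\mathcal{A})$, let $\mu$ be a probability measure on $(\mathcal{A},\mathcal{B}(\mathcal{A}))$, let $(X,\mathcal{X},\pi)$ be a probability space, and let $r:\mathcal{A}\times X\to[0,\infty]$ be a residual field over $(X,\mathcal{X},\pi)$, i.e. a $\mathcal{B}(\mathcal{A})\otimes\mathcal{X}$-measurable map. Let $\gamma,\alpha\in(0,1)$, $n\ge 1$, and let $A_1,\dots,A_{n+1}$ be exchangeable $\mathcal{A}$-valued random variables with common law $\mu$. Let $k=\lceil (n+1)(1-\alpha)\rceil$ and let $\hat\lambda^r$ be the $k$th smallest value among the scores $s^r(A_1),\dots,s^r(A_n)$ if $k\le n$, and $\hat\lambda^r=\infty$ otherwise. Then $$\mathbb{P}\bigl(w^r_{\hat\lambda^r}(A_{n+1})\ge 1-\gamma\bigr)\ \ge\ \frac{k}{n+1}\ \ge\ 1-\alpha .$$ Moreover, if the $A_i$ are i.i.d. and the law of $s^r(A_1)$ is atomless, then the random variable $\mathbb{P}\bigl(w^r_{\hat\lambda^r}(A_{n+1})\ge 1-\gamma \mid A_1,\dots,A_n\bigr)$ follows a $\mathrm{Beta}(k,n+1-k)$ distribution, and in particular $$\mathbb{P}\bigl(w^r_{\hat\lambda^r}(A_{n+1})\ge 1-\gamma\bigr)=\mathbb{E}\Bigl[\mathbb{P}\bigl(w^r_{\hat\lambda^r}(A_{n+1})\ge 1-\gamma \mid A_1,\dots,A_n\bigr)\Bigr]=\frac{k}{n+1}\ \le\ 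1-\alpha+\frac{1}{n+1}.$$
   Context: For $a\in\mathcal{A}$ and $\lambda\in[0,\infty]$, the containment fraction is $w^r_\lambda(a)=\pi(\{x\in X: r(a,x)\le\lambda\})$, and the nonconformity score is $s^r(a)=\inf\{\lambda\ge 0: w^r_\lambda(a)\ge 1-\gamma\}\in[0,\infty]$, with $\inf\emptyset=+\infty$. The ''$k$th smallest value'' is the $k$th order statistic, counted with multiplicity. *)

(* Defs.v *)
From HB Require Import structures.
From mathcomp Require Import all_boot all_order all_algebra all_fingroup.
From mathcomp Require Import all_classical all_reals all_analysis.
From mathcomp Require Import measurable_realfun.

Set Implicit Arguments.
Unset Strict Implicit.
Unset Printing Implicit Defensive.

Import Order.TTheory GRing.Theory Num.Theory.
Import numFieldNormedType.Exports.

Local Open Scope classical_set_scope.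
Local Open Scope ring_scope.
Local Open Scope ereal_scope.

Definition separable (T : topologicalType) : Prop :=
  exists2 D : set T, countable D & dense D.

Definition borelType (R : realType) (T : completeNormedModType R) :=
  g_sigma_algebraType (@open T).

HB.instance Definition _ (R : realType) (T : completeNormedModType R) :=
  Measurable.on (borelType T).

Section probability.
Context {d : measure_display} {W : measurableType d} {R : realType}.
Variable P : probability W R.

(* The product sigma-algebra on T^n is the one of n.-tuple T. *)
Definition joint_law {d' : measure_display} {T : measurableType d'} {n : nat}
    (X : 'I_n -> W -> T) : set (n.-tuple T) -> \bar R :=
  pushforward P (fun w => [tuple X i w | i < n]).

Definition exchangeable {d' : measure_display} {T : measurableType d'} {n : nat}
    (X : 'I_n -> W -> T) : Prop :=
  forall (s : 'S_n) (B : set (n.-tuple T)), measurable B ->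
    joint_law (fun i => X (s i)) B = joint_law X B.

Definition mutually_independent {d' : measure_display} {T : measurableType d'}
    {n : nat} (X : 'I_n -> W -> T) : Prop :=
  forall (J : {set 'I_n}) (B : 'I_n -> set T),
    (forall i, i \in J -> measurable (B i)) ->
    P (\bigcap_(i in [set` J]) (X i @^-1` B i)) =
    \prod_(i in J) P (X i @^-1` B i).

(* Y is a version of the conditional probability of the event E given the
   sub-sigma-algebra G. *)
Definition is_cond_prob (G : set (set W)) (E : set W) (Y : W -> R) : Prop :=
  [/\ forall B : set R, measurable B -> G (Y @^-1` B),
      P.-integrable [set: W] (EFin \o Y) &
      forall D, G D -> \int[P]_(w in D) (Y w)%:E = P (E `&` D)].

End probability.

(* For a finite Borel measure on \bar R this amounts to every singleton being
   null. *)
Definition atomless {d : measure_display} {T : measurableType d} {R : realType}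
    (m : set T -> \bar R) : Prop :=
  forall D, measurable D -> 0 < m D ->
    exists C, [/\ measurable C, C `<=` D & 0 < m C < m D].

(* Beta(a, b) for integers a > 0 and b >= 0, with the usual convention that
   Beta(a, 0) is the point mass at 1.  The library's beta_prob uses the
   exponent b.-1, so beta_prob a 0 would be Beta(a, 1). *)
Definition beta_law {R : realType} (a b : nat) (B : set (measurableTypeR R)) :
    \bar R :=
  if b == 0%N then dirac (1%R : measurableTypeR R) B else beta_prob a b B.

Section residual.
Context {R : realType} {T : completeNormedModType R}
        {dX : measure_display} {X : measurableType dX}.
Variable pi : probability X R.

Definition residual_field (r : borelType T * X -> \bar R) : Prop :=
  measurable_fun [set: borelType T * X] r /\ forall z, 0 <= r z.

Definition containment (r : borelType T * X -> \bar R) (l : \bar R)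
    (a : borelType T) : \bar R :=
  pi [set x | r (a, x) <= l].

(* The infimum is over real l >= 0; ereal_inf of the empty set is +oo. *)
Definition score (r : borelType T * X -> \bar R) (gamma : R)
    (a : borelType T) : \bar R :=
  ereal_inf [set l%:E | l in
    [set l : R | (0 <= l)%R /\ (1 - gamma)%:E <= containment r l%:E a]].

End residual.

(* k-th smallest entry of s, counted with multiplicity, for 1 <= k <= size s. *)
Definition order_statistic {R : realType} (s : seq (\bar R)) (k : nat) : \bar R :=
  nth +oo (sort <=%O s) k.-1.

Definition quantile_rank {R : realType} (n : nat) (alpha : R) : nat :=
  `|Num.ceil (n.+1%:R * (1 - alpha))%R|%N.

Definition conformal_threshold {R : realType} {T : completeNormedModType R}
    {dX : measure_display} {X : measurableType dX} (pi : probability X R)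
    (r : borelType T * X -> \bar R) (gamma alpha : R) (n : nat)
    (a : 'I_n -> borelType T) : \bar R :=
  if (quantile_rank n alpha <= n)%N
  then order_statistic [seq score pi r gamma (a i) | i <- enum 'I_n]
         (quantile_rank n alpha)
  else +oo.

(* The first n of n + 1 variables; the last one has index ord_max. *)
Definition calibration {S : Type} {n : nat} (A : 'I_n.+1 -> S) : 'I_n -> S :=
  fun i => A (widen_ord (leqnSn n) i).

(* Main.v *)
(* Write S_i for the score of A_i.  By right continuity of l |-> w_l(a), coverage
   at a threshold l >= 0 means S_{n+1} <= l, so the covered event says that fewer
   than k of the n + 1 scores lie strictly below S_{n+1}.  By exchangeability the
   analogous event for S_j has the same probability for each j, and at least k
   indices j always satisfy it; averaging over j gives the bound k / (n + 1).

   In the i.i.d. case let F be the distribution function of the scores.  Fubini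
   identifies F(lambda_hat) as a version of the conditional coverage.  Since the
   law of the scores has no atoms, each u in [0, 1] has a quantile t with F(t) = u
   and {F <= u} = {. <= t}, so F(lambda_hat) <= u means that at least k of
   S_1, ..., S_n are at most t.  This is a binomial tail in u, whose derivative
   telescopes to the Beta(k, n + 1 - k) density. *)

Require Import Defs.
From HB Require Import structures.
From mathcomp Require Import all_boot all_order all_algebra all_fingroup.
From mathcomp Require Import all_classical all_reals all_analysis.
From mathcomp Require Import measurable_realfun zify ring.

Set Implicit Arguments.
Unset Strict Implicit.
Unset Printing Implicit Defensive.

Import Order.TTheory GRing.Theory Num.Theory.
Import numFieldNormedType.Exports.

Local Open Scope classical_set_scope.
Local Open Scope ring_scope.
Local Open Scope ereal_scope.

(** * Ranks and order statistics *)

(** If the set C of such indices had fewer than k elements, an index of minimal value outside C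
    would have at most |C| < k values strictly below its own, and would lie in C. Counting strict
    inequalities makes ties harmless. *)
Lemma leq_card_rank_lt (d : Order.disp_t) (U : orderType d) (m k : nat)
    (x : 'I_m -> U) : (k <= m)%N ->
  (k <= #|[pred j | (#|[pred i | (x i < x j)%O]| < k)%N]|)%N.
Proof.
move=> km; rewrite leqNgt; apply/negP.
set C := [pred j | _] => Ck.
have [j0 j0C] : exists j, j \in [predC C].
  apply/card_gt0P.
  by rewrite -(leq_add2l #|C|) addn1 cardC card_ord (leq_trans Ck).
(* a minimal index outside C has only elements of C below it *)
case: (@Order.TotalTheory.arg_minP _ _ _ j0 [predC C] x j0C) => j jC jmin.
suff : j \in C by rewrite (negbTE jC).
rewrite inE (leq_ltn_trans _ Ck)// subset_leq_card//; apply/fintype.subsetP => i.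
rewrite inE => xij; rewrite -[i \in C]negbK; apply/negP => iC.
by have := jmin i iC; rewrite (lt_geF xij).
Qed.

(** Comparisons with an order statistic become counts, from below here and from above in the next
    lemma; this keeps sorting out of the later arguments. *)
Lemma le_order_statistic (R : realType) (s : seq (\bar R)) (k : nat) t :
  (0 < k <= size s)%N ->
  (t <= order_statistic s k) = (count (fun y => y < t)%O s < k)%N.
Proof.
case: k => // k /= ks; rewrite /order_statistic/= ltnS -(count_sort <=%O).
have ss := sort_le_sorted s.
apply/idP/idP; last first.
  by move=> h; apply: nth_count_ge => //; rewrite size_sort ks andbT.
by apply: contraTT; rewrite -ltnNge -ltNge => h; exact: nth_count_lt.
Qed.

Lemma order_statistic_le (R : realType) (s : seq (\bar R)) (k : nat) t :
  (0 < k <= size s)%N ->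
  (order_statistic s k <= t) = (k <= count (fun y => y <= t)%O s)%N.
Proof.
case: k => // k /= ks; rewrite /order_statistic/= -(count_sort <=%O).
have ss := sort_le_sorted s.
apply/idP/idP; last exact: nth_count_le.
apply: contraTT; rewrite -ltnNge -ltNge ltnS => h.
by apply: nth_count_gt => //; rewrite size_sort ks andbT.
Qed.

Lemma quantile_rank_bounds (R : realType) (n : nat) (alpha : R) :
  (0 < alpha < 1)%R ->
  [/\ (0 < quantile_rank n alpha <= n.+1)%N,
      (1 - alpha <= (quantile_rank n alpha)%:R / n.+1%:R)%R &
      ((quantile_rank n alpha)%:R / n.+1%:R <= 1 - alpha + 1 / n.+1%:R)%R].
Proof.
case/andP=> a0 a1; set x := (n.+1%:R * (1 - alpha))%R.
have n0 : (0 < n.+1%:R :> R)%R by rewrite ltr0n.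
have x0 : (0 < x)%R by rewrite mulr_gt0// subr_gt0.
(* [quantile_rank] is the absolute value of an integer ceiling; since x > 0 that ceiling is
   nonnegative and the absolute value changes nothing. *)
have kx : (quantile_rank n alpha)%:R = (Num.ceil x)%:~R :> R.
  rewrite /quantile_rank -/x pmulrn gez0_abs//.
  by rewrite ceil_ge0// (lt_trans _ x0)// oppr_lt0.
have xk : (x <= (quantile_rank n alpha)%:R)%R by rewrite kx; have /andP[] := ceil_itv x.
have kx1 : ((quantile_rank n alpha)%:R < x + 1)%R.
  by have := ceilB1_lt x; rewrite kx intrB ltrBlDr.
split.
(* The upper bound: k < x + 1 and x < n + 1 give k < n + 2. *)
- rewrite -(ltr_nat R) (lt_le_trans x0 xk)/= -ltnS -(ltr_nat R).
  rewrite (lt_trans kx1)// -natr1 ltrD2r /x gtr_pMr//.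
  by rewrite gtrBl.
- by rewrite ler_pdivlMr// mulrC.
- by rewrite ler_pdivrMr// mulrDl mulrC mul1r mulVf ?gt_eqF// ltW.
Qed.

(** * Containment and scores *)

Section measure_limits.
Context (d : measure_display) (W : measurableType d) (R : realType).
Variables (P : probability W R) (f : W -> \bar R).
Hypothesis mf : measurable_fun [set: W] f.

Lemma measurable_fun_le_cst (t : \bar R) : measurable [set w | f w <= t].
Proof. by rewrite -[X in measurable X]setTI; exact: emeasurable_fun_infty_c. Qed.

Lemma measurable_fun_lt_cst (t : \bar R) : measurable [set w | f w < t].
Proof. by rewrite -[X in measurable X]setTI; exact: emeasurable_fun_infty_o. Qed.

Lemma ge_probability_bigcap (F : (set W)^nat) (c : \bar R) :
  (forall m, measurable (F m)) -> {homo F : n m / (n <= m)%N >-> m `<=` n} ->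
  (forall m, c <= P (F m)) -> c <= P (\bigcap_m F m).
Proof.
move=> mF ndF cF.
have cv : P (F m) @[m --> \oo] --> P (\bigcap_m F m).
  apply: nonincreasing_cvg_mu => //.
  - by rewrite (le_lt_trans (probability_le1 _ _)) ?ltry.
  - exact: bigcap_measurable.
  - by move=> n m nm; apply/subsetPset; exact: ndF.
rewrite -(cvg_lim _ cv)//; apply: lime_ge; first by apply/cvg_ex; eexists; exact: cv.
exact: nearW.
Qed.

Lemma le_probability_bigcup (F : (set W)^nat) (c : \bar R) :
  (forall m, measurable (F m)) -> {homo F : n m / (n <= m)%N >-> n `<=` m} ->
  (forall m, P (F m) <= c) -> P (\bigcup_m F m) <= c.
Proof.
move=> mF ndF cF.
have cv : P (F m) @[m --> \oo] --> P (\bigcup_m F m).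
  apply: nondecreasing_cvg_mu => //; first exact: bigcup_measurable.
  by move=> n m nm; apply/subsetPset; exact: ndF.
rewrite -(cvg_lim _ cv)//; apply: lime_le; first by apply/cvg_ex; eexists; exact: cv.
exact: nearW.
Qed.

(** Right continuity of the distribution function of f: continuity from above along the levels l +
    1/(m + 1). *)
Lemma ge_probability_le_cst (c : \bar R) (l : R) :
  (forall l', (l < l')%R -> c <= P [set w | f w <= l'%:E]) ->
  c <= P [set w | f w <= l%:E].
Proof.
move=> h.
have -> : [set w | f w <= l%:E] =
    \bigcap_m [set w | f w <= (l + m.+1%:R^-1)%:E].
  apply/seteqP; split => [w /= fl m _|w /= fl].
    by apply: (le_trans fl); rewrite lee_fin lerDl.
  have {}fl m : f w <= (l + m.+1%:R^-1)%:E := fl m I.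
  rewrite leNgt; apply/negP => lf.
  case: (f w) fl lf => [y| |] fl.
  - rewrite lte_fin => /ltr_add_invr[m]; apply/negP; rewrite -leNgt -lee_fin.
    exact: fl.
  - by move=> _; have := fl 0%N; rewrite leye_eq.
  - by [].
apply: ge_probability_bigcap => [m|n m nm w /=|m].
- exact: measurable_fun_le_cst.
- by move=> /le_trans; apply; rewrite lee_fin lerD2l lef_pV2 ?posrE// ler_nat.
- by apply: h; rewrite ltrDl.
Qed.

Lemma le_probability_lt_cst (c : \bar R) (l : \bar R) :
  -oo < l ->
  (forall l' : R, l'%:E < l -> P [set w | f w <= l'%:E] <= c) ->
  (forall w, -oo < f w) ->
  P [set w | f w < l] <= c.
Proof.
move=> l0 h fNy.
(* Reals below l that exhaust the levels below it: l - 1/(m + 1) for finite l, and m for l = +oo.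
   The remaining branch is excluded by [l0]. *)
pose u m : R := if l is y%:E then (y - m.+1%:R^-1)%R else m%:R.
have ul m : (u m)%:E < l.
  by rewrite /u; case: l l0 {h u} => [y| |]//= _; rewrite ?ltry// lte_fin gtrBl.
have -> : [set w | f w < l] = \bigcup_m [set w | f w <= (u m)%:E].
  apply/seteqP; split => [w /= fl|w [m _ /= fl]]; last exact: le_lt_trans (ul m).
  suff [m fm] : exists m, f w <= (u m)%:E by exists m.
  have := fNy w; case: (f w) fl => [z| |]//= zl _; last first.
    by move: zl; rewrite ltNge leey.
  rewrite /u.
  case: l zl {l0 h u ul} => [y| |]//=.
  - rewrite lte_fin => /ltr_add_invr[m zy]; exists m.
    by rewrite lee_fin lerBrDr ltW.
  - by move=> _; exists (Num.truncn z).+1; rewrite lee_fin ltW ?truncnS_gt.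
apply: le_probability_bigcup => [m|n m nm w /=|m].
- exact: measurable_fun_le_cst.
- move=> /le_trans; apply; rewrite lee_fin /u; case: l {l0 h u ul} => [y| |]//=;
    by rewrite ?ler_nat// lerB// lef_pV2 ?posrE// ler_nat.
- exact: h.
Qed.

End measure_limits.

Section residual_scores.
Context {R : realType} {T : completeNormedModType R}
        {dX : measure_display} {X : measurableType dX}.
Variables (pi : probability X R) (r : borelType T * X -> \bar R) (gamma : R).
Hypotheses (hr : residual_field r) (hgamma : (0 < gamma < 1)%R).

Lemma score_ge0 a : 0 <= score pi r gamma a.
Proof. by apply/ereal_infP => _ [l [l0 _] <-]; rewrite lee_fin. Qed.

Lemma le_containment (a : borelType T) (l : \bar R) : 0 <= l ->
  ((1 - gamma)%:E <= containment pi r l a) = (score pi r gamma a <= l).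
Proof.
case/andP: hgamma => g0 g1; have [mr r0] := hr.
have mra : measurable_fun [set: X] (fun x => r (a, x)).
  by apply: (measurableT_comp mr).
case: l => [l| |]// l0; last first.
  rewrite leey /containment (_ : [set x | _] = setT); last first.
    by apply/seteqP; split => // x _ /=; rewrite leey.
  by rewrite probability_setT lee_fin lerBlDr lerDl ltW.
apply/idP/idP => h; first by apply: ge_ereal_inf; exists l%:E => //; exists l.
apply: ge_probability_le_cst => // l' ll'.
have : score pi r gamma a < l'%:E by rewrite (le_lt_trans h)// lte_fin.
case/ereal_inf_lt => _ [l1 [l10 h1] <-] l1l'.
apply: (le_trans h1); apply: le_measure; rewrite ?inE.
- exact: measurable_fun_le_cst.
- exact: measurable_fun_le_cst.
- by move=> x /= /le_trans; apply; exact: ltW.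
Qed.

(** For l >= 0, [le_containment] turns the set where the score exceeds l into the set where the
    containment fraction at l is below 1 - gamma; that fraction is the measure of a section of a
    measurable sublevel set of r. For l < 0 the set is everything. *)
Lemma measurable_score : measurable_fun [set: borelType T] (score pi r gamma).
Proof.
have [mr r0] := hr.
apply: (measurability (@ErealGenOInfty.G R)); first exact: ErealGenOInfty.measurableE.
move=> _ [_ [l ->] <-]; rewrite setTI.
have [l0|l0] := leP 0%R l; last first.
  rewrite (_ : _ @^-1` _ = setT)//; apply/seteqP; split => // a _ /=.
  by rewrite in_itv/= andbT (lt_le_trans _ (score_ge0 a)).
rewrite (_ : _ @^-1` _ = [set a | containment pi r l%:E a < (1 - gamma)%:E]).
  apply: measurable_fun_lt_cst; rewrite /containment.
  have mrl : measurable [set z | r z <= l%:E] by exact: measurable_fun_le_cst.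
  rewrite (_ : (fun a => _) = pi \o xsection [set z | r z <= l%:E]).
    exact: measurable_fun_xsection.
  by apply/funext => a /=; rewrite /xsection/=; congr (pi _); apply/seteqP;
    split => x; rewrite /= inE.
apply/funext => a; apply/propext.
by rewrite /= in_itv/= andbT !ltNge le_containment.
Qed.

End residual_scores.

(** * Exchangeability *)

(** The count depends only on the set J of indices that satisfy b, so the event is a finite union,
    over the admissible J, of finite intersections. Rank events, threshold events and binomial
    events all have this form. *)
Lemma measurable_card_pred (d : measure_display) (Y : measurableType d) (m : nat)
    (b : 'I_m -> Y -> bool) (Q : pred nat) :
  (forall i, measurable [set y | b i y]) ->
  measurable [set y | Q #|[pred i | b i y]|].
Proof.
move=> mb.
have -> : [set y | Q #|[pred i | b i y]|] =
    \bigcup_(J in [set J : {set 'I_m} | Q #|J|])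
      \big[setI/setT]_(i < m) [set y | b i y = (i \in J)].
  apply/seteqP; split => [y /= Qy|y [J /= QJ]].
    exists [set i | b i y]%SET; first by rewrite /= cardsE.
    by rewrite -bigcap_seq => i _ /=; rewrite inE.
  rewrite -bigcap_seq => yJ; congr (Q _) : QJ => /=.
  by apply: eq_card => i; rewrite inE (yJ i)//= mem_index_enum.
apply: fin_bigcup_measurable => [|J _]; first exact: finite_finset.
apply: bigsetI_measurable => i _.
have [iJ|iJ] := boolP (i \in J).
  rewrite (_ : [set y | _] = [set y | b i y]); first exact: mb.
  by apply/seteqP; split.
rewrite (_ : [set y | _] = ~` [set y | b i y]); first exact: measurableC.
by apply/seteqP; split => y /=; [move=> -> | move/negP/negbTE].
Qed.

(** Double counting: (m + 1) p is the sum of the P(E_j), which is the integral of the number of j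
    such that E_j occurs, and this number is at least k everywhere. *)
Lemma equiprobable_cover (d : measure_display) (W : measurableType d)
    (R : realType) (P : probability W R) (m k : nat) (E : 'I_m.+1 -> W -> bool)
    (p : R) :
  (forall j, measurable [set w | E j w]) ->
  (forall j, P [set w | E j w] = p%:E) ->
  (forall w, (k <= #|[pred j | E j w]|)%N) -> (k%:R / m.+1%:R <= p)%R.
Proof.
move=> mE PE kE; rewrite ler_pdivrMr ?ltr0n// -lee_fin.
have -> : (p * m.+1%:R)%:E = \sum_(j < m.+1) P [set w | E j w].
  under eq_bigr do rewrite PE.
  by rewrite sumEFin sumr_const card_ord mulr_natr.
have -> : \sum_(j < m.+1) P [set w | E j w] =
    \int[P]_w \sum_(j < m.+1) (\1_[set w | E j w] w)%:E.
  rewrite ge0_integral_sum//=; last first.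
  - by move=> j _; apply: (@measurableT_comp _ _ _ _ _ _ EFin) => //; exact: measurable_indic.
  - by apply: eq_bigr => j _; rewrite integral_indic// setIT.
apply: (@le_trans _ _ (\int[P]_w (k%:R : R)%:E)).
  by rewrite integral_cst//= probability_setT mule1.
apply: ge0_le_integral => //=.
- apply: emeasurable_sum => j.
  by apply: (@measurableT_comp _ _ _ _ _ _ EFin).
- move=> w _; rewrite sumEFin lee_fin.
  under eq_bigr do rewrite indicE.
  rewrite -natr_sum ler_nat (leq_trans (kE w))// -sum1_card big_mkcond/=.
  by apply: leq_sum => j _; rewrite inE; case: ifP => // Ew; rewrite mem_set.
Qed.

(** Exchangeability is applied to the transposition of j and [ord_max], with B the set of tuples
    whose last entry has fewer than k scores strictly below its own. The count runs over all
    indices, so reindexing it by the transposition leaves it unchanged. *)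
Lemma exchangeable_rank (d : measure_display) (W : measurableType d)
    (R : realType) (P : probability W R) (d' : measure_display)
    (T : measurableType d') (n k : nat) (A : 'I_n.+1 -> W -> T)
    (sc : T -> \bar R) :
  (forall i, measurable_fun [set: W] (A i)) -> measurable_fun [set: T] sc ->
  exchangeable P A -> forall j,
  P [set w | (#|[pred i | (sc (A i w) < sc (A j w))%O]| < k)%N] =
  P [set w | (#|[pred i | (sc (A i w) < sc (A ord_max w))%O]| < k)%N].
Proof.
move=> mA msc exA j.
pose B := [set t : n.+1.-tuple T |
  (#|[pred i | (sc (tnth t i) < sc (tnth t ord_max))%O]| < k)%N].
have mB : measurable B.
  apply: (@measurable_card_pred _ _ _
    (fun i (t : n.+1.-tuple T) => (sc (tnth t i) < sc (tnth t ord_max))%O)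
    (fun c => c < k)%N) => i.
  rewrite -[X in measurable X]setTI; apply: emeasurable_fun_lt => //;
    by apply: (measurableT_comp msc); exact: measurable_tnth.
have := exA (tperm j ord_max) B mB; rewrite /joint_law /pushforward/= => exB.
transitivity (P ((fun w => [tuple A (tperm j ord_max i) w | i < n.+1]) @^-1` B)).
  congr (P _); apply/funext => w; apply/propext; rewrite /B/= tnth_mktuple tpermR.
  rewrite -!sum1_card (reindex_inj (@perm_inj _ (tperm j ord_max)))/=.
  by under [in X in _ <-> is_true X]eq_bigl do rewrite inE tnth_mktuple.
rewrite exB; congr (P _); apply/funext => w; apply/propext; rewrite /B/= tnth_mktuple.
rewrite -!sum1_card.
by under [in X in is_true X <-> _]eq_bigl do rewrite inE tnth_mktuple.
Qed.

(** * Independence *)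

(** The joint law of (U, V) agrees with the product of the marginal laws on rectangles, hence
    everywhere; the product measure of M is then an integral of measures of sections. *)
Lemma independent_pair_integral (d : measure_display) (W : measurableType d)
    (R : realType) (P : probability W R) (d1 d2 : measure_display)
    (T1 : measurableType d1) (T2 : measurableType d2)
    (U : {RV P >-> T1}) (V : {RV P >-> T2}) :
  (forall B1 B2, measurable B1 -> measurable B2 ->
     P (U @^-1` B1 `&` V @^-1` B2) = P (U @^-1` B1) * P (V @^-1` B2)) ->
  forall M, measurable M ->
  P [set w | M (U w, V w)] = \int[P]_w P [set v | M (U w, V v)].
Proof.
move=> UV M mM.
have mUV : measurable_fun [set: W] (fun w => (U w, V w)).
  exact: measurable_fun_pair.
pose UVm : {mfun W >-> (T1 * T2)%type} := mfun_Sub (mem_set mUV).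
transitivity (distribution P UVm M); first by [].
rewrite -(@product_measure_unique _ _ _ _ _ (distribution P U) (distribution P V)
  (distribution P UVm) UV M mM).
rewrite /product_measure1 ge0_integral_distribution//=; last first.
  exact: measurable_fun_xsection.
apply: eq_integral => w _; rewrite /distribution/pushforward/=.
by congr (P _); apply/funext => v; apply/propext; rewrite /xsection/= inE.
Qed.

Lemma mem_g_sigma_preimage (d' : measure_display) (T : measurableType d')
    (W : Type) (n : nat) (f : 'I_n -> W -> T) i B :
  measurable B -> g_sigma_preimage f (f i @^-1` B).
Proof.
move=> mB; apply: sub_sigma_algebra; rewrite -bigcup_seq; exists i => /=.
  by rewrite mem_index_enum.
by exists B => //; rewrite setTI.
Qed.

Lemma calibration_lift (S : Type) (n : nat) (A : 'I_n.+1 -> S) i :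
  calibration A i = A (lift ord_max i).
Proof. by rewrite /calibration; congr A; apply/val_inj; rewrite /= /bump leqNgt ltn_ord. Qed.

Section independent.
Context (d : measure_display) (W : measurableType d) (R : realType)
  (P : probability W R) (d' : measure_display) (T : measurableType d') (n : nat).
Variable A : 'I_n.+1 -> {RV P >-> T}.
Hypothesis indA : mutually_independent P (fun i => A i : W -> T).

Let calA := calibration (fun i => A i : W -> T).

Lemma measurable_calibration i : measurable_fun [set: W] (calA i).
Proof. by rewrite /calA/calibration. Qed.

Lemma independent_boxes (B : 'I_n -> set T) (C : set T) :
  (forall i, measurable (B i)) -> measurable C ->
  P ((\bigcap_i (calA i @^-1` B i)) `&` A ord_max @^-1` C) =
  (\prod_i P (calA i @^-1` B i)) * P (A ord_max @^-1` C).
Proof.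
move=> mB mC.
(* The n calibration sets and C are glued into one family on n + 1 indices, so that independence can
   be used on the full index set. *)
pose B' (j : 'I_n.+1) := if unlift ord_max j is Some i then B i else C.
have B'l i : B' (widen_ord (leqnSn n) i) = B i.
  rewrite /B' (_ : widen_ord _ i = lift ord_max i) ?liftK//.
  by apply/val_inj; rewrite /= /bump leqNgt ltn_ord.
have B'm : B' ord_max = C by rewrite /B' unlift_none.
have := @indA [set: 'I_n.+1]%SET B'.
rewrite (eq_bigl xpredT); last by move=> i; rewrite inE.
rewrite big_ord_recr/= B'm; under eq_bigr do rewrite B'l.
move=> <-; last by move=> i _; rewrite /B'; case: unlift.
congr (P _); apply/seteqP; split => [w [wB wC] j _ /=|w wB].
- rewrite /B'; case: unliftP => [i|] -> //.
  by have := wB i I; rewrite /calA calibration_lift.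
- split; last by have := wB ord_max; rewrite B'm; apply; rewrite /= inE.
  by move=> i _; have := wB (widen_ord (leqnSn n) i); rewrite B'l; apply; rewrite /= inE.
Qed.

Lemma independent_boxesT (B : 'I_n -> set T) : (forall i, measurable (B i)) ->
  P (\bigcap_i (calA i @^-1` B i)) = \prod_i P (calA i @^-1` B i).
Proof.
move=> mB; have := @independent_boxes B setT mB measurableT.
by rewrite preimage_setT setIT probability_setT mule1.
Qed.

Lemma g_sigma_preimage_measurable : g_sigma_preimage calA `<=` measurable.
Proof.
apply: smallest_sub; first exact: sigma_algebra_measurable.
rewrite -bigcup_seq => D [i _ [B mB <-]].
exact: measurable_calibration.
Qed.

(** A pi-system argument in D: the restriction of P to the event on the last variable and P scaled
    by the probability of that event are finite measures. They agree on boxes, which are stable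
    under intersection and generate the calibration sigma-algebra. *)
Lemma independent_last (D : set W) (C : set T) : g_sigma_preimage calA D ->
  measurable C -> P (D `&` A ord_max @^-1` C) = P D * P (A ord_max @^-1` C).
Proof.
move=> GD mC.
pose G := [set D | exists2 B : 'I_n -> set T, (forall i, measurable (B i)) &
  D = \bigcap_i (calA i @^-1` B i)].
have mlast : measurable (A ord_max @^-1` C) by exact: measurable_funPTI.
have p0 : (0 <= fine (P (A ord_max @^-1` C)))%R by rewrite fine_ge0.
have -> : P (D `&` A ord_max @^-1` C) = mrestr P mlast D by [].
have scaleE X : mscale (NngNum p0) P X = P X * P (A ord_max @^-1` C).
  by rewrite /mscale/= fineK ?fin_num_measure// muleC.
rewrite -scaleE.
apply: (@g_sigma_algebra_measure_unique _ _ _ G _ (fun=> setT)).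
- move=> _ [B mB ->]; apply: fin_bigcap_measurable => // i _.
  by rewrite -[X in measurable X]setTI; exact: measurable_calibration.
- by move=> _; exists (fun=> setT) => //; apply/seteqP; split => // w _ i _.
- by rewrite bigcup_const//; exists 0%N.
- move=> _ _ [B mB ->] [B' mB' ->]; exists (fun i => B i `&` B' i).
    by move=> i; exact: measurableI.
  by rewrite -bigcapI.
- move=> _ [B mB ->]; apply: etrans (esym (scaleE _)).
  by rewrite /= /mrestr independent_boxes// independent_boxesT.
- move=> _; change (P (setT `&` A ord_max @^-1` C) < +oo).
  by rewrite (le_lt_trans (probability_le1 _ _)) ?ltry ?setTI.
- move: GD; apply: smallest_sub; first exact: smallest_sigma_algebra.
  rewrite -bigcup_seq => E [i _ [B mB <-]]; rewrite setTI.
  (* A generator is a box that constrains a single coordinate. *)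
  apply: sub_sigma_algebra; exists (fun j => if j == i then B else setT).
    by move=> j; case: ifP.
  apply/seteqP; split => [w wB j _ /=|w /(_ i I)]; last by rewrite /= eqxx.
  by case: eqVneq => // ->.
Qed.

End independent.

(** * Atomless laws and their quantiles *)

Lemma atomless_set1 (d : measure_display) (W : measurableType d) (R : realType)
    (P : probability W R) (S : W -> \bar R) :
  atomless (pushforward P S) -> forall t, P [set w | S w = t] = 0.
Proof.
move=> atS t; apply/eqP; apply/negPn/negP => Pt0.
have : 0 < pushforward P S [set t].
  by rewrite lt0e; apply/andP; split => //; rewrite /pushforward measure_ge0.
case/(atS [set t] (emeasurable_set1 t)) => C [_ Ct].
(* A subset of a singleton is empty or the whole singleton, so its mass is never strictly
   intermediate. *)
have [->|->] := subset_set1 Ct; first by rewrite /pushforward preimage_set0 measure0 ltxx.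
by rewrite ltxx andbF.
Qed.

Section quantile.
Context (d : measure_display) (W : measurableType d) (R : realType)
  (P : probability W R) (S : W -> \bar R).
Hypotheses (mS : measurable_fun [set: W] S) (S0 : forall w, 0 <= S w)
  (atS : forall t, P [set w | S w = t] = 0).

Let F t := P [set w | S w <= t].

(** The quantile t is the supremum of the set where F <= u, the right end of any plateau of F at
    height u; this is what makes the equivalence hold for every s. Absence of atoms gives left
    continuity, hence F t <= u, and right continuity gives F t >= u. *)
Lemma quantile_ex (u : R) : (0 <= u <= 1)%R ->
  exists t, F t = u%:E /\ forall s, (F s <= u%:E) = (s <= t).
Proof.
case/andP => u0 u1; pose E := [set s | F s <= u%:E]; pose t := ereal_sup E.
have Fnd s s' : s <= s' -> F s <= F s'.
  move=> ss'; apply: le_measure; rewrite ?inE; try exact: measurable_fun_le_cst.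
  by move=> w /= /le_trans; apply.
(* The level 0 lies in E because F 0 = P(S = 0) = 0 <= u; this also rules out t = -oo. *)
have t0 : 0 <= t.
  apply: le_ereal_sup_tmp; exists 0 => //; rewrite /E/= /F.
  rewrite (_ : [set w | _] = [set w | S w = 0]) ?atS ?lee_fin//.
  apply/seteqP; split => w /=; last by move=> ->.
  by move=> Sw; apply/eqP; rewrite eq_le Sw S0.
have Ft_lt : F t = P [set w | S w < t].
  rewrite /F (_ : [set w | S w <= t] = [set w | S w < t] `|` [set w | S w = t]).
    apply/eqP; rewrite eq_le; apply/andP; split.
      rewrite -[leRHS]adde0 -(atS t); apply: measureU2.
        exact: measurable_fun_lt_cst.
      by rewrite -[X in measurable X]setTI; exact: (mS _ (emeasurable_set1 t)).
    apply: le_measure; rewrite ?inE; first exact: measurable_fun_lt_cst.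
      apply: measurableU; first exact: measurable_fun_lt_cst.
      by rewrite -[X in measurable X]setTI; exact: (mS _ (emeasurable_set1 t)).
    by move=> w; left.
  apply/seteqP; split => w /=; first by rewrite le_eqVlt => /orP[/eqP|]; tauto.
  by case=> [/ltW//|->].
have Ftu : F t <= u%:E.
  rewrite Ft_lt; apply: le_probability_lt_cst => //.
  - by rewrite (lt_le_trans _ t0).
  - move=> l /ereal_sup_gt[s Es ls]; apply: le_trans Es; apply: Fnd; exact: ltW.
  - by move=> w; rewrite (lt_le_trans _ (S0 w)).
exists t; split; last first.
  move=> s; apply/idP/idP => [Fs|st]; last exact: le_trans (Fnd _ _ st) Ftu.
  by apply: le_ereal_sup_tmp; exists s.
apply/eqP; rewrite eq_le Ftu/=.
have tE s : t < s -> u%:E <= F s.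
  move=> ts; rewrite leNgt; apply/negP => /ltW Fs.
  by move: ts; apply/negP; rewrite -leNgt; apply: le_ereal_sup_tmp; exists s.
case: (t) t0 tE => [x| |]// _ tE.
  by apply: ge_probability_le_cst => // l xl; apply: tE; rewrite lte_fin.
rewrite /F (_ : [set w | _] = setT) ?probability_setT ?lee_fin//.
by apply/seteqP; split => w //= _; rewrite leey.
Qed.

End quantile.

(** * Binomial counts and the beta distribution *)

Section binomial_count.
Context (d : measure_display) (W : measurableType d) (R : realType)
  (P : probability W R) (d' : measure_display) (T : measurableType d') (n : nat).
Variable A : 'I_n.+1 -> {RV P >-> T}.
Hypothesis indA : mutually_independent P (fun i => A i : W -> T).

Let calA := calibration (fun i => A i : W -> T).

(** The event is split according to the exact set J of successes. By independence each J contributes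
    p^|J| (1 - p)^(n - |J|), and 'C(n, j) sets have j elements. *)
Lemma binomial_count (k : nat) (b : T -> bool) (p : R) :
  measurable [set x | b x] ->
  (forall i, P [set w | b (calA i w)] = p%:E) ->
  P [set w | (k <= #|[pred i | b (calA i w)]|)%N] =
  (\sum_(j < n.+1 | (k <= j)%N) binomial_pmf n p j)%:E.
Proof.
move=> mb bp.
pose C (J : {set 'I_n}) i := if i \in J then [set x | b x] else ~` [set x | b x].
have mC J i : measurable (C J i) by rewrite /C; case: ifP => // _; exact: measurableC.
pose box J := \bigcap_i (calA i @^-1` C J i).
have mbox J : measurable (box J).
  apply: fin_bigcap_measurable => // i _.
  by rewrite -[X in measurable X]setTI; exact: measurable_calibration.
have boxE J w : box J w <-> J = [set i | b (calA i w)]%SET.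
  split => [Jw|-> i _]; last first.
    suff : C [set i | b (calA i w)]%SET i (calA i w) by [].
    by rewrite /C inE; case: ifP => //= ->.
  apply/setP => i; rewrite inE; have : C J i (calA i w) := Jw i I.
  by rewrite /C; case: ifP => _ /= => [->|/negP/negbTE ->].
have Pbox J : P (box J) = (p ^+ #|J| * (1 - p) ^+ (n - #|J|))%R%:E.
  rewrite (independent_boxesT indA)//.
  transitivity (\prod_(i < n) (if i \in J then p else (1 - p)%R)%:E).
    apply: eq_bigr => i _; rewrite /C; case: ifP => _; first exact: bp.
    rewrite preimage_setC probability_setC; last first.
      by rewrite -[X in measurable X]setTI; exact: (measurable_calibration A i measurableT mb).
    by rewrite [P _]bp EFinB.
  rewrite prodEFin; congr EFin; rewrite (bigID (mem J))/=.
  under eq_bigr => i -> do [].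
  under [X in (_ * X)%R]eq_bigr => i /negbTE -> do [].
  rewrite !prodr_const; congr (_ * _ ^+ _)%R.
  by rewrite -[X in (X - _)%N](card_ord n) -(cardC (mem J)) addKn; exact: eq_card.
pose E (J : {set 'I_n}) := if (k <= #|J|)%N then box J else set0.
have mE J : measurable (E J) by rewrite /E; case: ifP.
have mev : measurable [set w | (k <= #|[pred i | b (calA i w)]|)%N].
  apply: (@measurable_card_pred _ _ _ (fun i w => b (calA i w)) (fun c => k <= c)%N) => i.
  rewrite -[X in measurable X]setTI.
  exact: (measurable_calibration A i measurableT mb).
(* Additivity over the disjoint boxes is obtained by integrating an identity of indicators: at w
   only the set of actual successes contributes. *)
transitivity (\sum_(J : {set 'I_n}) P (E J)).
  transitivity (\int[P]_w \sum_(J : {set 'I_n}) (\1_(E J) w)%:E).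
    transitivity (\int[P]_w
        (\1_[set w | (k <= #|[pred i | b (calA i w)]|)%N] w)%:E).
      by rewrite integral_indic// setIT.
    apply: eq_integral => w _.
    rewrite sumEFin; congr EFin; set Jw := [set i | b (calA i w)]%SET.
    have cJw : #|[pred i | b (calA i w)]| = #|Jw| by rewrite cardsE.
    rewrite (bigD1 Jw)//= big1 ?addr0; last first.
      move=> J JJw; rewrite indicE memNset// /E; case: ifP => [_ bJ|_ []//].
      by move/eqP: JJw; apply; exact: (proj1 (boxE _ _) bJ).
    rewrite !indicE; congr (_%:R); rewrite /E -cJw.
    case: ifPn => kJ; last by rewrite in_set0 memNset//=; exact/negP.
    by rewrite !mem_set//; exact: (proj2 (boxE _ _) erefl).
  rewrite ge0_integral_sum//=.
    by apply: eq_bigr => J _; rewrite integral_indic// setIT.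
  by move=> J; apply: (@measurableT_comp _ _ _ _ _ _ EFin) => //; exact: measurable_indic.
transitivity (\sum_(J : {set 'I_n} | (k <= #|J|)%N) (p ^+ #|J| * (1 - p) ^+ (n - #|J|))%R%:E).
  rewrite [RHS]big_mkcond; apply: eq_bigr => J _; rewrite /E.
  by case: ifP => // _; rewrite measure0.
rewrite sumEFin; congr EFin.
have cJ (J : {set 'I_n}) : (#|J| < n.+1)%N by rewrite ltnS -[leqRHS]card_ord max_card.
rewrite (partition_big (fun J : {set 'I_n} => Ordinal (cJ J)) (fun j => k <= j)%N)//=.
apply: eq_bigr => j kj; rewrite /binomial_pmf -[X in 'C(X, _)](card_ord n) -card_draws -sumr_const.
apply: eq_big => [J|J /andP[_ /eqP <-]//].
by rewrite inE -val_eqE/=; case: eqP => [->|]; rewrite ?kj ?andbF.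
Qed.

End binomial_count.

(** * The beta distribution function as a binomial tail, and the beta mean *)

Section beta_cdf.
Context {R : realType}.
Local Open Scope ring_scope.

(* The derivative of the j-th binomial weight is slope j - slope (j + 1), hence
   sums of consecutive weights have a one-term derivative. *)
Let binomial_slope (n j : nat) (u : R) :=
  u ^+ j.-1 * (1 - u) ^+ (n - j) *+ (j * 'C(n, j)).

Lemma is_derive_binomial_pmf (n j : nat) (u : R) : (j <= n)%N ->
  is_derive u 1 (fun v => binomial_pmf n v j)
    (binomial_slope n j u - binomial_slope n j.+1 u).
Proof.
move=> jn.
have d1 : is_derive u 1 ((id : R -> R) ^+ j) ((j%:R * u ^+ j.-1) *: 1).
  exact: is_deriveX.
have d2 : is_derive u 1 ((cst 1 - id : R -> R) ^+ (n - j))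
    (((n - j)%:R * (1 - u) ^+ (n - j).-1) *: (0 - 1)).
  exact: is_deriveX.
have d3 := is_deriveZ 'C(n, j)%:R (is_deriveM d1 d2).
have -> : (fun v => binomial_pmf n v j) =
    'C(n, j)%:R *: ((id : R -> R) ^+ j * (cst 1 - id : R -> R) ^+ (n - j)).
  apply/funext => v; rewrite /binomial_pmf !fctE/=.
  by rewrite /GRing.scale/= mulr_natl.
apply: is_derive_eq d3 _.
(* The identity (j + 1) 'C(n, j + 1) = (n - j) 'C(n, j) matches the second term of the product rule
   with the slope of index j + 1. *)
rewrite /binomial_slope mul_bin_left subnS !fctE /GRing.scale/=.
rewrite -[X in _ = X - _]mulr_natr -[X in _ = _ - X]mulr_natr !natrM.
move: 'C(n, j)%:R (n - j)%:R j%:R (u ^+ j) (u ^+ j.-1) => a b c e f.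
by move: ((1 - u) ^+ (n - j)) ((1 - u) ^+ (n - j).-1) => g h; ring.
Qed.

Definition binomial_tail (n k : nat) (u : R) : R :=
  \sum_(j < n.+1 | (k <= j)%N) binomial_pmf n u j.

(** Downward induction on k, telescoping the slopes. It starts at k = n + 1, where the sum is empty
    and the slope vanishes because 'C(n, n + 1) = 0. *)
Lemma is_derive_binomial_tail (n k : nat) (u : R) : (k <= n.+1)%N ->
  is_derive u 1 (binomial_tail n k) (binomial_slope n k u).
Proof.
move=> kn; rewrite -(subKn kn); elim: (n.+1 - k)%N => [|m IHm].
  rewrite subn0 /binomial_slope bin_small// muln0 mulr0n.
  rewrite (_ : binomial_tail _ _ = cst 0); first exact: is_derive_cst.
  apply/funext => v; rewrite /binomial_tail big_pred0//= => j.
  by rewrite leqNgt ltn_ord.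
(* Truncated subtraction: once m reaches n + 1 the index stays at 0 and the induction hypothesis is
   already the goal. *)
have [mn|nm] := leqP n.+1 m.
  have e : (n.+1 - m.+1 = n.+1 - m)%N by lia.
  by rewrite e.
have mnn : (n.+1 - m.+1 <= n)%N by lia.
have e : (n.+1 - m = (n.+1 - m.+1).+1)%N by lia.
rewrite e in IHm; set k' := (n.+1 - m.+1)%N in mnn IHm *.
rewrite (_ : binomial_tail n k' =
    (fun v => binomial_pmf n v k') + binomial_tail n k'.+1); last first.
  apply/funext => v; rewrite /binomial_tail !fctE.
  rewrite (bigD1 (Ordinal (mnn : (k' < n.+1)%N)))/=; last by [].
  by congr (_ + _); apply: eq_bigl => j; rewrite -val_eqE/= ltn_neqAle eq_sym andbC.
apply: is_derive_eq; first exact: is_deriveD (is_derive_binomial_pmf u mnn) IHm.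
by rewrite subrK.
Qed.

Lemma binomial_tail0 (n k : nat) : (0 < k)%N -> binomial_tail n k 0 = 0.
Proof.
move=> k0; rewrite /binomial_tail big1// => j kj; rewrite /binomial_pmf.
by rewrite expr0n (gtn_eqF (leq_trans k0 kj)) mul0r mul0rn.
Qed.

(** Since k 'C(n, k) = n! / ((k - 1)! (n - k)!) = 1 / B(k, n + 1 - k), the slope is given on [0, 1]
    by the beta density. *)
Lemma binomial_slopeE (n k : nat) (u : R) : (0 < k <= n)%N ->
  binomial_slope n k u = XMonemX k.-1 (n.+1 - k).-1 u / beta_fun k (n.+1 - k).
Proof.
case: k => // k kn; have e : (n.+1 - k.+1 = (n - k.+1).+1)%N by lia.
rewrite e /binomial_slope/= /XMonemX beta_fun_fact -[LHS]mulr_natr; congr (_ * _).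
rewrite (_ : (k + (n - k.+1)).+1 = n); last by lia.
rewrite -(bin_fact kn) factS !natrM !invfM !invrK.
have f0 m : m`!%:R != 0 :> R by rewrite pnatr_eq0 -lt0n fact_gt0.
move: (f0 k) (f0 (n - k.+1)%N) k.+1%:R 'C(n, k.+1)%:R.
move: k`!%:R (n - k.+1)`!%:R => a b a0 b0 c y. by field; rewrite a0 b0.
Qed.

(** The beta density vanishes outside [0, 1], so only the integral over [0, u] remains; there the
    density is the derivative of the binomial tail, which is 0 at 0. *)
Lemma beta_prob_le (n k : nat) (u : R) : (0 < k <= n)%N -> 0 <= u <= 1 ->
  beta_prob k (n.+1 - k) [set x | x <= u] = (binomial_tail n k u)%:E.
Proof.
move=> kn /andP[u0 u1]; have [k0 _] := andP kn.
rewrite (_ : [set x | x <= u] = `]-oo, u]%classic); last first.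
  by apply/seteqP; split => x; rewrite /= in_itv.
rewrite -integral_beta_pdf//.
transitivity (\int[lebesgue_measure]_(x in `[0%R, u]) (binomial_slope n k x)%:E)%E.
  rewrite [LHS]integral_mkcond [RHS]integral_mkcond; apply: eq_integral => x _.
  rewrite !patchE; have [x0u|] := boolP (x \in `[0, u]%classic).
    move: (x0u); rewrite inE/= in_itv/= => /andP[x0 xu].
    rewrite ifT ?inE/= ?in_itv//= /beta_pdf patchE ifT ?binomial_slopeE//.
    by rewrite inE/= in_itv/= x0 (le_trans xu).
  move=> /negP x0u; case: ifPn => // /set_mem; rewrite /= in_itv/= => xu.
  rewrite /beta_pdf patchE ifF ?mul0r//; apply/negP => /set_mem/=.
  by rewrite in_itv/= => /andP[x0 _]; apply/x0u/mem_set; rewrite /= in_itv/= x0.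
(* The fundamental theorem of calculus is applied on a nondegenerate interval, so u = 0 is treated
   apart. *)
have [->|un0] := eqVneq u 0.
  by rewrite set_itv1 integral_set1 binomial_tail0.
have cT k' : (k' <= n.+1)%N -> continuous (binomial_tail n k').
  move=> kn' x; apply: differentiable_continuous; apply/derivable1_diffP.
  exact: (@ex_derive _ _ _ _ _ _ _ (is_derive_binomial_tail x kn')).
have kn1 : (k <= n.+1)%N by case/andP: kn => _ /leqW.
rewrite (@continuous_FTC2 _ _ (binomial_tail n k)) ?binomial_tail0 ?sube0//.
- by rewrite lt_neqAle eq_sym un0.
- apply: continuous_subspaceT.
  rewrite (_ : binomial_slope n k =
     fun x => XMonemX k.-1 (n.+1 - k).-1 x * (beta_fun k (n.+1 - k))^-1); last first.
    by apply/funext => x; rewrite binomial_slopeE.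
  move=> x; apply: cvgM; last exact: cvg_cst.
  exact: continuous_XMonemX.
- split.
  + by move=> x _; exact: (@ex_derive _ _ _ _ _ _ _ (is_derive_binomial_tail x kn1)).
  + by apply: cvg_at_right_filter; exact: cT.
  + by apply: cvg_at_left_filter; exact: cT.
- move=> x _; rewrite derive1E.
  exact: (@derive_val _ _ _ _ _ _ _ (is_derive_binomial_tail x kn1)).
Qed.

(** Multiplying the density by x raises the first exponent by one, so the mean is B(a + 1, b) / B(a,
    b), a ratio of factorials. *)
Lemma beta_prob_mean (a b : nat) : (0 < a)%N -> (0 < b)%N ->
  (beta_prob a b).-integrable setT (EFin : measurableTypeR R -> \bar R) ->
  (\int[@beta_prob R a b]_x x%:E = (a%:R / (a + b)%:R)%:E)%E.
Proof.
move=> a0 b0 /integrableP[mE iE].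
rewrite integral_beta_prob//.
transitivity (\int[lebesgue_measure]_(x in [set: measurableTypeR R])
    (((@XMonemX R a.+1.-1 b.-1 \_ `[0, 1]) (x : R))%:E * (beta_fun a b)^-1%:E)%E)%E.
  apply: eq_integral => x _; rewrite /beta_pdf !patchE; case: ifP => _.
    rewrite -!EFinM; congr EFin; rewrite mulrA; congr (_ * _).
    by rewrite /XMonemX mulrA -exprS prednK.
  by rewrite mul0r mule0 mul0e.
rewrite ge0_integralZr//=.
- transitivity ((@beta_fun R a.+1 b)%:E * (beta_fun a b)^-1%:E)%E; first by rewrite EFin_beta_fun.
  rewrite -EFinM; congr EFin.
  case: a a0 {mE iE} => // a _; case: b b0 => // b _.
  rewrite !beta_fun_fact !addSn addnS !factS !natrM !invfM !invrK.
  have f0 m : m`!%:R != 0 :> R by rewrite pnatr_eq0 -lt0n fact_gt0.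
  have n0 m : m.+1%:R != 0 :> R by rewrite pnatr_eq0.
  move: (f0 a) (f0 b) (f0 (a + b)%N) (n0 a) (n0 (a + b)%N) (n0 (a + b).+1).
  move: a`!%:R b`!%:R (a + b)`!%:R a.+1%:R (a + b).+1%:R (a + b).+2%:R.
  move=> x y z t v w x0 y0 z0 t0 v0 w0; field.
  by rewrite x0 y0 z0 v0 w0.
- apply: (@measurableT_comp _ _ _ _ _ _ EFin) => //.
  by apply/measurable_restrict => //=; rewrite setTI; exact: measurable_XMonemX.
- move=> x _; rewrite lee_fin patchE; case: ifPn => // /set_mem/= x01.
  exact: XMonemX_ge0.
- by rewrite lee_fin invr_ge0 beta_fun_ge0.
Qed.

End beta_cdf.

(** * Conditional coverage *)

(** The complements ]u, +oo[ of the given half-lines form a pi-system that generates the Borel sets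
    and covers the line. *)
Lemma eq_probability_le (R : realType) (P Q : probability (measurableTypeR R) R) :
  (forall u : R, P [set x | (x <= u)%R] = Q [set x | (x <= u)%R]) ->
  forall B, measurable B -> P B = Q B.
Proof.
move=> PQ; have itvE (u : R) : `]u, +oo[%classic = ~` [set x | (x <= u)%R].
  by apply/seteqP; split => x /=; rewrite in_itv/= andbT ltNge => /negP.
have mle (u : R) : measurable ([set x | (x <= u)%R] : set (measurableTypeR R)).
  by rewrite -[X in measurable X]setCK -itvE; exact: measurableC.
apply: (@measure_unique _ R (measurableTypeR R) (@RGenOInfty.G R)
  (fun k => `](- k%:R)%R, +oo[%classic)).
- exact: RGenOInfty.measurableE.
- move=> _ _ [x ->] [y ->]; exists (Order.max x y).
  by apply/seteqP; split => z /=; rewrite !in_itv/= !andbT gt_max => /andP.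
- by move=> k; eexists.
- apply/seteqP; split => // x _; exists (Num.truncn `|x|).+1 => //=.
  rewrite in_itv/= andbT ltrNl (le_lt_trans _ (truncnS_gt _))//.
  by rewrite -normrN ler_norm.
- move=> _ [u ->]; rewrite itvE.
  apply: etrans (probability_setC P (mle u)) _; rewrite PQ.
  exact: esym (probability_setC Q (mle u)).
- by move=> k; rewrite (le_lt_trans (probability_le1 _ _)) ?ltry.
Qed.

Section conditional_probability.
Context (d : measure_display) (W : measurableType d) (R : realType)
  (P : probability W R) (G : set (set W)) (E : set W).
Hypotheses (GW : <<s G >> `<=` measurable) (mE : measurable E).

Let GT := g_sigma_algebraType G.

(** The set D where Y < Y' belongs to the conditioning sigma-algebra, so both functions have the
    integral P(E [&] D) over it. The difference is positive on D with integral 0, hence D is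
    null. *)
Lemma is_cond_prob_le (Y Y' : W -> R) :
  is_cond_prob P <<s G >> E Y -> is_cond_prob P <<s G >> E Y' ->
  P [set w | (Y w < Y' w)%R] = 0.
Proof.
move=> [mY iY EY] [mY' iY' EY'].
have mYG : measurable_fun [set: GT] (Y : GT -> R) by move=> _ B /mY; rewrite setTI.
have mYG' : measurable_fun [set: GT] (Y' : GT -> R) by move=> _ B /mY'; rewrite setTI.
set D := [set w | _].
have GD : <<s G >> D.
  have := measurable_fun_ltr mYG mYG' measurableT (Y := [set true]) I.
  by rewrite setTI.
have mD : measurable D by exact: GW.
have iYD : P.-integrable D (EFin \o Y) by exact: integrableS iY.
have iYD' : P.-integrable D (EFin \o Y') by exact: integrableS iY'.
have D0 : \int[P]_(w in D) `|((Y' w)%:E - (Y w)%:E)| = 0.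
  under eq_integral.
    move=> w /set_mem wD; rewrite gee0_abs; last first.
      by rewrite -EFinB lee_fin subr_ge0 ltW.
    over.
  rewrite integralB// EY// EY'// subee// fin_num_measure//.
  by apply: measurableI.
have /(ae_eq_integral_abs P mD) : measurable_fun D (fun w => (Y' w)%:E - (Y w)%:E).
  by have /measurable_int := integrableB mD iYD' iYD.
case=> /(_ D0) [N [mN PN DN]] _.
apply: subset_measure0 PN => // w wD; apply: DN => /= /(_ wD).
rewrite -EFinB => -[/eqP]; apply/negP.
by rewrite subr_eq0 gt_eqF.
Qed.

(** Two versions differ only on a null set, so they have the same law. A claim about every version
    thus reduces to one explicit version. *)
Lemma is_cond_prob_unique (Y Y' : W -> R) (B : set R) :
  is_cond_prob P <<s G >> E Y -> is_cond_prob P <<s G >> E Y' -> measurable B ->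
  P (Y @^-1` B) = P (Y' @^-1` B).
Proof.
move=> cY cY' mB; suff le (Z Z' : W -> R) : is_cond_prob P <<s G >> E Z ->
    is_cond_prob P <<s G >> E Z' -> P (Z @^-1` B) <= P (Z' @^-1` B).
  by apply/eqP; rewrite eq_le !le.
move=> cZ cZ'; have [mZ _ _] := cZ; have [mZ' _ _] := cZ'.
have mlt (X X' : W -> R) : is_cond_prob P <<s G >> E X ->
    is_cond_prob P <<s G >> E X' -> measurable [set w | (X w < X' w)%R].
  move=> [mX _ _] [mX' _ _].
  have mXW : measurable_fun [set: W] X by move=> _ C /mX; rewrite setTI; exact: GW.
  have mXW' : measurable_fun [set: W] X' by move=> _ C /mX'; rewrite setTI; exact: GW.
  by have := measurable_fun_ltr mXW mXW' measurableT (Y := [set true]) I; rewrite setTI.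
pose N := [set w | (Z w < Z' w)%R] `|` [set w | (Z' w < Z w)%R].
have mN : measurable N by apply: measurableU; exact: mlt.
have PN : P N <= 0.
  have : P N <= P [set w | (Z w < Z' w)%R] + P [set w | (Z' w < Z w)%R].
    by apply: measureU2; apply: mlt.
  by rewrite (is_cond_prob_le cZ cZ') (is_cond_prob_le cZ' cZ) adde0.
rewrite -[leRHS]adde0; apply: (@le_trans _ _ (P (Z' @^-1` B) + P N)); last exact: leeD2l.
have mZB : measurable (Z @^-1` B) by apply: GW; exact: mZ.
have mZB' : measurable (Z' @^-1` B) by apply: GW; exact: mZ'.
apply: (@le_trans _ _ (P (Z' @^-1` B `|` N))); last exact: measureU2.
apply: le_measure; rewrite ?inE//; first exact: measurableU.
move=> w ZB; have [lt|lt|e] := ltgtP (Z w) (Z' w).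
- by right; left.
- by right; right.
- by left; rewrite /= -e.
Qed.

End conditional_probability.

(** The threshold as a function of the scores alone: [conformal_threshold] is convertible to it, so
    the rank and independence arguments can ignore the residual field. *)
Definition rank_threshold (R : realType) (n k : nat) (x : 'I_n -> \bar R) : \bar R :=
  if (k <= n)%N then order_statistic [seq x i | i <- enum 'I_n] k else +oo.

Section rank_threshold.
Context (R : realType) (n k : nat).
Hypothesis k0 : (0 < k)%N.

Lemma count_map_enum (x : 'I_n -> \bar R) (p : pred (\bar R)) :
  count p [seq x i | i <- enum 'I_n] = #|[pred i | p (x i)]|.
Proof. by rewrite count_map enumT cardE /enum_mem size_filter; apply: eq_count. Qed.

Lemma rank_threshold_le (x : 'I_n -> \bar R) t : (k <= n)%N ->
  (rank_threshold k x <= t) = (k <= #|[pred i | (x i <= t)%O]|)%N.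
Proof.
move=> kn; rewrite /rank_threshold kn order_statistic_le ?count_map_enum//.
by rewrite k0 size_map size_enum_ord.
Qed.

(** The last value is not strictly below itself, so counting over n + 1 or over n indices gives the
    same number. If k > n the threshold is +oo and the count, at most n, is below k. *)
Lemma le_rank_threshold (x : 'I_n.+1 -> \bar R) : (k <= n.+1)%N ->
  (x ord_max <= rank_threshold k (calibration x)) =
  (#|[pred i | (x i < x ord_max)%O]| < k)%N.
Proof.
move=> kn.
have -> : #|[pred i | (x i < x ord_max)%O]| =
          #|[pred i | (calibration x i < x ord_max)%O]|.
  rewrite -!sum1_card big_mkcond big_ord_recr/= inE ltxx addn0 [RHS]big_mkcond/=.
  by apply: eq_bigr => i _; rewrite !inE.
rewrite /rank_threshold; case: ifPn => kn'.
  by rewrite le_order_statistic ?count_map_enum// k0 size_map size_enum_ord.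
rewrite leey; apply/esym; rewrite -ltnNge in kn'.
by rewrite (leq_ltn_trans _ kn')// -[leqRHS]card_ord max_card.
Qed.

Lemma rank_threshold_ge0 (x : 'I_n -> \bar R) :
  (forall i, 0 <= x i) -> 0 <= rank_threshold k x.
Proof.
move=> x0; rewrite /rank_threshold; case: ifPn => // kn.
rewrite le_order_statistic ?count_map_enum; last first.
  by rewrite k0 size_map size_enum_ord.
by rewrite eq_card0// => i; rewrite inE; apply/negbTE; rewrite -leNgt.
Qed.

Lemma measurable_rank_threshold (d : measure_display) (Y : measurableType d)
    (x : 'I_n -> Y -> \bar R) :
  (forall i, measurable_fun [set: Y] (x i)) ->
  measurable_fun [set: Y] (fun y => rank_threshold k (x ^~ y)).
Proof.
move=> mx; have [kn|kn] := leqP k n; last first.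
  by rewrite (_ : (fun y => _) = cst +oo)//; apply/funext => y;
    rewrite /rank_threshold leqNgt kn.
apply: (measurability (@ErealGenOInfty.G R)); first exact: ErealGenOInfty.measurableE.
move=> _ [_ [l ->] <-]; rewrite setTI.
rewrite (_ : _ @^-1` _ =
  [set y | (fun c => ~~ (k <= c)%N) #|[pred i | (x i y <= l%:E)%O]|]).
  apply: (@measurable_card_pred _ _ _ (fun i y => (x i y <= l%:E)%O)
    (fun c => ~~ (k <= c)%N)) => i.
  exact: measurable_fun_le_cst.
apply/funext => y; apply/propext.
by rewrite /= in_itv/= andbT ltNge rank_threshold_le.
Qed.

End rank_threshold.

(** * An explicit version of the conditional coverage, and its law *)

Section conditional_coverage.
Context (d : measure_display) (W : measurableType d) (R : realType)
  (P : probability W R) (d' : measure_display) (T : measurableType d') (n k : nat).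
Variables (A : 'I_n.+1 -> {RV P >-> T}) (sc : T -> \bar R).
Hypotheses (indA : mutually_independent P (fun i => A i : W -> T))
  (msc : measurable_fun [set: T] sc) (k0 : (0 < k)%N).

Let calA := calibration (fun i => A i : W -> T).
Let L w := rank_threshold k (fun i => sc (calA i w)).
Let F t := P [set w | sc (A ord_max w) <= t].

(** The candidate version: the calibration data are frozen at w and the last variable is integrated
    out. [fine] loses nothing, as F takes values in [0, 1]. *)
Definition conditional_coverage (w : W) : R := fine (F (L w)).

Let G := \big[setU/set0]_(i < n) preimage_set_system setT (calA i) measurable.
Let GT := g_sigma_algebraType G.

Let mLG : measurable_fun [set: GT] (L : GT -> \bar R).
Proof.
apply: (@measurable_rank_threshold _ _ _ k0 _ _ (fun i (w : GT) => sc (calA i w))) => i.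
apply: (measurableT_comp msc) => _ B mB; rewrite setTI.
exact: mem_g_sigma_preimage.
Qed.

Let GW : <<s G >> `<=` measurable.
Proof. exact: g_sigma_preimage_measurable. Qed.

Let mscA i : measurable_fun [set: W] (fun w => sc (A i w)).
Proof. exact: measurableT_comp. Qed.

(** F t is the measure of the section at t of the set of pairs z with z.2 <= z.1. *)
Let mF : measurable_fun [set: \bar R] F.
Proof.
pose S : {mfun W >-> \bar R} := mfun_Sub (mem_set (mscA ord_max)).
have mM : measurable [set z : \bar R * \bar R | z.2 <= z.1].
  by rewrite -[X in measurable X]setTI; apply: emeasurable_fun_le.
have := @measurable_fun_xsection _ _ _ _ _ (distribution P S) _ mM.
rewrite (_ : _ \o _ = F)//; apply/funext => t /=.
rewrite /distribution/pushforward/F/=; congr (P _); apply/funext => w.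
by apply/propext; rewrite /xsection/= inE.
Qed.

Let F_fin t : (fine (F t))%:E = F t.
Proof. by rewrite fineK// fin_num_measure//; exact: measurable_fun_le_cst. Qed.

Lemma conditional_coverage_ge0_le1 w : (0 <= conditional_coverage w <= 1)%R.
Proof. by rewrite -!lee_fin F_fin measure_ge0 probability_le1//; exact: measurable_fun_le_cst. Qed.

(** For D in the calibration sigma-algebra, coverage together with D is a measurable condition M on
    the pair (w, last variable). By independence the last variable is integrated for fixed w, which
    leaves F (L w) on D and 0 off D. *)
Lemma is_cond_prob_coverage :
  is_cond_prob P (g_sigma_preimage calA)
    [set w | sc (A ord_max w) <= rank_threshold k (fun i => sc (calA i w))]
    conditional_coverage.
Proof.
have mYG : measurable_fun [set: GT] (conditional_coverage : GT -> R).
  have mFL : measurable_fun [set: GT] (fun w => F (L w)) by exact: measurableT_comp.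
  exact: (measurableT_comp (fine_measurable measurableT) mFL).
have mY : measurable_fun [set: W] conditional_coverage.
  by move=> _ B mB; rewrite setTI; apply: GW; have := mYG measurableT B mB; rewrite setTI.
split.
- by move=> B mB; have := mYG measurableT B mB; rewrite setTI.
- apply: (@le_integrable _ _ _ P _ measurableT _ (cst 1)) => //=.
  + exact/measurable_EFinP.
  + move=> w _; have /andP[Y0 Y1] := conditional_coverage_ge0_le1 w.
    by rewrite normr1 lee_fin ger0_norm.
  + exact: finite_measure_integrable_cst.
move=> D GD.
(* The identity into W with the calibration sigma-algebra is independent of the
   last variable: this avoids tuples of calibration points. *)
have mU : measurable_fun [set: W] (id : W -> GT).
  by move=> _ B mB; rewrite setTI preimage_id; exact: GW.
pose U : {mfun W >-> GT} := mfun_Sub (mem_set mU).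
pose M : set (GT * T) := (D `*` setT) `&` [set z | sc z.2 <= L z.1].
have mM : measurable M.
  apply: measurableI; first by apply: measurableX.
  rewrite -[X in measurable X]setTI; apply: emeasurable_fun_le => //.
  - exact: (measurableT_comp msc measurable_snd).
  - exact: (measurableT_comp mLG measurable_fst).
have ind B1 B2 : measurable B1 -> measurable B2 ->
    P (U @^-1` B1 `&` A ord_max @^-1` B2) = P (U @^-1` B1) * P (A ord_max @^-1` B2).
  exact: independent_last.
have := independent_pair_integral ind mM.
rewrite (_ : [set w | M (U w, A ord_max w)] =
    [set w | sc (A ord_max w) <= L w] `&` D); last first.
  by apply/seteqP; split => w /=; rewrite /M/=; tauto.
move=> ->; rewrite integral_mkcond; apply: eq_integral => w _.
rewrite patchE; case: ifPn => wD.
  rewrite F_fin; congr (P _); apply/seteqP; split => v /=; rewrite /M/=; last tauto.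
  by move=> sL; split => //; split => //; exact: set_mem.
rewrite (_ : [set v | _] = set0) ?measure0//; apply/seteqP; split => v //=.
by rewrite /M/= => -[[/mem_set wD' _] _]; move: wD; rewrite wD'.
Qed.

Lemma is_cond_prob_coverage_unique (Y : W -> R) (B : set R) :
  is_cond_prob P (g_sigma_preimage calA)
    [set w | sc (A ord_max w) <= rank_threshold k (fun i => sc (calA i w))] Y ->
  measurable B -> P (Y @^-1` B) = P (conditional_coverage @^-1` B).
Proof.
move=> cY mB; apply: (is_cond_prob_unique GW _ cY is_cond_prob_coverage mB).
rewrite -[X in measurable X]setTI; apply: emeasurable_fun_le => //.
by move=> _ C mC; rewrite setTI; apply: GW; have := mLG measurableT mC; rewrite setTI.
Qed.

(** When k > n the threshold is +oo and the explicit version is identically 1. *)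
Lemma conditional_coverage_law_gt (Y : W -> R) (B : set (measurableTypeR R)) :
  (n < k)%N ->
  is_cond_prob P (g_sigma_preimage calA)
    [set w | sc (A ord_max w) <= rank_threshold k (fun i => sc (calA i w))] Y ->
  measurable B -> P (Y @^-1` B) = dirac (1%R : measurableTypeR R) B.
Proof.
move=> nk cY mB; rewrite (is_cond_prob_coverage_unique cY mB).
have cc1 w : conditional_coverage w = 1%R.
  rewrite /conditional_coverage /L /rank_threshold leqNgt nk/= /F.
  rewrite (_ : [set v | _] = setT) ?probability_setT//.
  by apply/seteqP; split => // v _ /=; rewrite leey.
rewrite diracE; have [B1|B1] := boolP (_ \in B).
  rewrite (_ : _ @^-1` _ = setT) ?probability_setT//.
  by apply/seteqP; split => // w _ /=; rewrite cc1; exact: set_mem.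
rewrite (_ : _ @^-1` _ = set0) ?measure0//; apply/seteqP; split => // w /=.
by rewrite cc1 => /mem_set; apply/negP.
Qed.

Hypothesis lawA : forall i B, measurable B ->
  P (A i @^-1` B) = P (A ord_max @^-1` B).
Hypotheses (sc0 : forall a, 0 <= sc a)
  (atS : forall t, P [set w | sc (A ord_max w) = t] = 0).

Lemma conditional_coverage_le (u : R) : (k <= n)%N -> (0 <= u <= 1)%R ->
  P [set w | (conditional_coverage w <= u)%R] = beta_prob k (n.+1 - k) [set x | (x <= u)%R].
Proof.
move=> kn u01; rewrite beta_prob_le ?k0//.
have [t [Ft tP]] := quantile_ex (mscA ord_max) (fun w => sc0 (A ord_max w)) atS u01.
rewrite -(@binomial_count _ _ _ _ _ _ _ A indA k (fun a => sc a <= t) u); last 2 first.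
- exact: measurable_fun_le_cst.
- move=> i; rewrite -Ft.
  rewrite [LHS](lawA _ (measurable_fun_le_cst msc t)).
  by [].
congr (P _); apply/funext => w; apply/propext => /=.
by rewrite -lee_fin F_fin tP rank_threshold_le.
Qed.

Lemma conditional_coverage_law (Y : {RV P >-> R}) : (k <= n)%N ->
  is_cond_prob P (g_sigma_preimage calA)
    [set w | sc (A ord_max w) <= rank_threshold k (fun i => sc (calA i w))] Y ->
  forall B : set (measurableTypeR R), measurable B ->
  distribution P Y B = beta_prob k (n.+1 - k) B.
Proof.
move=> kn cY B mB.
have mle (u : R) : measurable ([set x | (x <= u)%R] : set (measurableTypeR R)).
  rewrite (_ : [set x | _] = `]-oo, u]%classic); first exact: measurable_itv.
  by apply/seteqP; split => x; rewrite /= in_itv.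
have mY : measurable_fun [set: W] (Y : W -> measurableTypeR R).
  exact: (@measurable_funPT _ _ _ _ Y).
(* The same function, with its target read as the measurable space that carries [beta_prob]. *)
pose Y' : {mfun W >-> measurableTypeR R} :=
  @mfun_Sub _ _ W (measurableTypeR R) Y (mem_set mY).
apply: (@eq_probability_le R (distribution P Y') (beta_prob k (n.+1 - k)) _ B mB) => u.
rewrite [LHS](is_cond_prob_coverage_unique cY (mle u)).
have [u0|u0] := ltP u 0%R.
  rewrite (_ : _ @^-1` _ = set0) ?measure0; last first.
    apply/seteqP; split => w //=; apply/negP; rewrite -ltNge (lt_le_trans u0)//.
    by have /andP[] := conditional_coverage_ge0_le1 w.
  apply/esym/eqP; rewrite eq_le measure_ge0 andbT.
  (* Below 0 the beta mass is bounded by its value at 0, a binomial tail that vanishes there because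
     k > 0. *)
  apply: (@le_trans _ _ (beta_prob k (n.+1 - k) [set x | (x <= 0)%R])).
    apply: le_measure; rewrite ?inE//.
    by move=> x /= /le_trans; apply; exact: ltW.
  by rewrite beta_prob_le ?k0 ?lexx ?ler01// binomial_tail0.
have [u1|u1] := leP u 1%R; first by rewrite conditional_coverage_le ?u0.
(* Above 1 both distribution functions equal 1, by monotonicity from the value at u = 1. *)
have cov1 : P [set w | (conditional_coverage w <= 1)%R] = 1.
  rewrite (_ : [set w | _] = setT) ?probability_setT//; apply/seteqP; split => // w _ /=.
  by have /andP[] := conditional_coverage_ge0_le1 w.
have mcc (v : R) : measurable [set w | (conditional_coverage w <= v)%R].
  by apply: GW; have [mC _ _] := is_cond_prob_coverage; exact: mC (mle v).
transitivity (1 : \bar R).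
  apply/eqP; rewrite eq_le; apply/andP; split; first exact: (probability_le1 _ (mcc u)).
  rewrite -cov1; apply: le_measure; rewrite ?inE.
  - exact: mcc.
  - exact: (mcc u).
  - by move=> w /= /le_trans; apply; exact: ltW.
apply/esym/eqP; rewrite eq_le; apply/andP; split.
  exact: (probability_le1 _ (mle u)).
rewrite -cov1 conditional_coverage_le ?ler01 ?lexx//.
apply: le_measure; rewrite ?inE.
- exact: mle.
- exact: mle.
- by move=> x /= /le_trans; apply; exact: ltW.
Qed.

End conditional_coverage.

(** * The coverage theorem *)

Theorem theoremA8 (R : realType) (T : completeNormedModType R)
    (hT : separable T) (mu : probability (borelType T) R)
    (dX : measure_display) (X : measurableType dX) (pi : probability X R)
    (r : borelType T * X -> \bar R) (hr : residual_field r)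
    (gamma alpha : R) (hgamma : (0 < gamma < 1)%R) (halpha : (0 < alpha < 1)%R)
    (n : nat) (hn : (1 <= n)%N)
    (d : measure_display) (W : measurableType d) (P : probability W R)
    (A : 'I_n.+1 -> {RV P >-> borelType T})
    (hexch : exchangeable P (fun i => A i : W -> borelType T))
    (hlaw : forall (i : 'I_n.+1) (B : set (borelType T)), measurable B ->
       distribution P (A i) B = mu B) :
  let k := quantile_rank n alpha in
  let lambda_hat := fun w : W =>
    conformal_threshold pi r gamma alpha (calibration (fun i => A i w)) in
  let covered :=
    [set w : W | (1 - gamma)%:E <= containment pi r (lambda_hat w) (A ord_max w)] in
  let sigmaA := g_sigma_preimage (calibration (fun i => A i : W -> borelType T)) in
  [/\ (k%:R / n.+1%:R)%:E <= P covered,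
      (1 - alpha <= k%:R / n.+1%:R :> R)%R &
      mutually_independent P (fun i => A i : W -> borelType T) ->
      atomless (pushforward P (fun w => score pi r gamma (A ord0 w))) ->
      [/\ exists Y : {RV P >-> R}, is_cond_prob P sigmaA covered Y,
          forall Y : {RV P >-> R}, is_cond_prob P sigmaA covered Y ->
            [/\ forall B : set (measurableTypeR R), measurable B ->
                  distribution P Y B = beta_law k (n.+1 - k) B,
                P covered = 'E_P[Y] &
                'E_P[Y] = (k%:R / n.+1%:R)%:E] &
          (k%:R / n.+1%:R <= 1 - alpha + 1 / n.+1%:R :> R)%R]].
Proof.
move=> k lambda_hat covered sigmaA.
have [k0n k_ge k_le] := quantile_rank_bounds n halpha; have /andP[k0 kn1] := k0n.
pose sc := score pi r gamma.
have msc : measurable_fun [set: borelType T] sc by exact: measurable_score.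
have sc0 a : 0 <= sc a by exact: score_ge0.
have lambdaE w : lambda_hat w = rank_threshold k (calibration (fun i => sc (A i w))) by [].
(* Nonnegativity of the threshold is what allows [le_containment] to be applied at it. *)
have lambda0 w : 0 <= lambda_hat w.
  by rewrite lambdaE; apply: rank_threshold_ge0 => // i; exact: sc0.
have coveredE : covered = [set w | sc (A ord_max w) <=
    rank_threshold k (calibration (fun i => sc (A i w)))].
  apply/funext => w; apply/propext.
  by rewrite /covered/= le_containment// lambdaE.
have coveredE' : covered =
    [set w | (#|[pred i | (sc (A i w) < sc (A ord_max w))%O]| < k)%N].
  rewrite coveredE; apply/funext => w; apply/propext => /=.
  by rewrite (le_rank_threshold k0 (fun i => sc (A i w))).
have mscA i : measurable_fun [set: W] (fun w => sc (A i w)) by exact: measurableT_comp.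
pose rank_lt j w := (#|[pred i | (sc (A i w) < sc (A j w))%O]| < k)%N.
have mrank j : measurable [set w | rank_lt j w].
  apply: (@measurable_card_pred _ _ _ (fun i w => (sc (A i w) < sc (A j w))%O)
    (fun c => c < k)%N) => i.
  by rewrite -[X in measurable X]setTI; exact: emeasurable_fun_lt.
have mcov : measurable covered by rewrite coveredE'; exact: mrank.
have cov_ge : (k%:R / n.+1%:R)%:E <= P covered.
  rewrite -[P covered]fineK ?fin_num_measure// lee_fin.
  apply: (@equiprobable_cover _ _ _ P _ _ rank_lt) => // [j|w].
    rewrite fineK ?fin_num_measure// coveredE'.
    apply: (@exchangeable_rank _ _ _ P _ _ n k (fun i => A i : W -> borelType T)
      sc _ msc hexch j) => i.
    exact: measurable_funPT.
  exact: leq_card_rank_lt.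
split => // indA atA.
have lawA i B : measurable B -> P (A i @^-1` B) = P (A ord_max @^-1` B).
  by move=> mB; have := hlaw i B mB; rewrite -(hlaw ord_max B mB).
(* The atomless law is assumed for the first variable and carried to the last one by the common
   law. *)
have atS t : P [set w | sc (A ord_max w) = t] = 0.
  rewrite -(atomless_set1 atA t).
  have mt : measurable (sc @^-1` [set t]).
    by rewrite -[X in measurable X]setTI; exact: msc (emeasurable_set1 t).
  exact: esym (lawA ord0 _ mt).
have cP := is_cond_prob_coverage indA msc k0.
split => //.
  have mY : measurable_fun [set: W] (conditional_coverage k A sc).
    move=> _ B mB; rewrite setTI.
    by apply: (@g_sigma_preimage_measurable _ _ _ P _ _ _ A); have [mY _ _] := cP; exact: mY.
  by exists (mfun_Sub (mem_set mY)); rewrite coveredE.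
move=> Y cY; have [_ iY EY] := cY.
(* The defining identity of the conditional probability, taken on the whole space. *)
have PcE : P covered = 'E_P[Y].
  rewrite expectation_def -[covered]setIT -EY//.
  exact: (@measurableT _ (g_sigma_algebraType _)).
have [kn|kn] := leqP k n.
  have Ylaw := @conditional_coverage_law _ _ _ P _ _ _ k A sc indA msc k0 lawA sc0 atS Y kn.
  rewrite -[X in is_cond_prob _ _ X _ -> _]coveredE in Ylaw.
  have {}Ylaw := Ylaw cY.
  split => //.
    move=> B mB; rewrite Ylaw// /beta_law ifF//.
    by apply/negbTE; rewrite -lt0n subn_gt0 ltnS.
  rewrite expectation_def.
  have mY : measurable_fun [set: W] (Y : W -> measurableTypeR R).
    exact: (@measurable_funPT _ _ _ _ Y).
  pose Y' : {mfun W >-> measurableTypeR R} :=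
    @mfun_Sub _ _ W (measurableTypeR R) Y (mem_set mY).
  have mE : measurable_fun [set: measurableTypeR R] (EFin : measurableTypeR R -> \bar R).
    exact: EFin_measurable.
  transitivity (\int[distribution P Y']_x (x : R)%:E).
    by rewrite integral_distribution.
  rewrite (@eq_measure_integral _ _ _ _ (beta_prob k (n.+1 - k))); last first.
    by move=> B mB _; exact: Ylaw.
  rewrite beta_prob_mean ?subn_gt0//; first by rewrite subnKC.
  (* Integrability of the identity under the beta law is inherited from that of Y, whose law it
     is. *)
  have iY' : (distribution P Y').-integrable setT (EFin : measurableTypeR R -> \bar R).
    exact: integrable_pushforward.
  apply/integrableP; split => //; have /integrableP[_] := iY'.
  rewrite (@eq_measure_integral _ _ _ _ (beta_prob k (n.+1 - k)))//.
  by move=> B mB _; exact: Ylaw.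
(* In the remaining case k = n + 1, and the lower bound already forces coverage with probability
   1. *)
have kE : k = n.+1 by apply/eqP; rewrite eqn_leq kn1 kn.
have PY1 : P covered = 1.
  apply/eqP; rewrite eq_le probability_le1//=.
  by apply: le_trans cov_ge; rewrite kE divff.
split => //; last by rewrite -PcE PY1 kE divff.
move=> B mB; rewrite {2}kE subnn /beta_law eqxx.
rewrite coveredE in cY.
exact: (conditional_coverage_law_gt indA msc k0 kn cY mB).
Qed.
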